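(* Let $d\ge1$, let $D\subset\mathbb{R}^d$ be Lebesgue measurable, let $f:D\to\mathbb{R}$ be bounded, let $r>0$ and let $0<\alpha\le 1$. Then $$|osc_r f|_{\alpha;gH}\le 2\Big(\sup_D f-\inf_D f\Big)\,\mu(Conv(D))\left(\frac{2d+1}{r}\right)^{\alpha},$$ where $Conv(D)$ is the convex hull of $D$.
   Context: $B_r(x):=\{y\in\mathbb{R}^d: |y-x|<r\}$ is the open Euclidean ball. For a function $g:D\to\mathbb{R}$ and $\rho>0$, the $\rho$-oscillation is $(osc_\rho g)(x):=\sup_{y\in B_\rho(x)\cap D} g(y)-\inf_{y\in B_\rho(x)\cap D} g(y)$ for $x\in D$ (a Lebesgue measurable function $D\to[0,\infty]$). Fix a constant $c>0$ and let $\mu=c\cdot Leb$, where $Leb$ is Lebesgue measure on $\mathbb{R}^d$. For $0<\alpha\le1$, the generalized $\alpha$-Hölder seminorm of $g:D\to\mathbb{R}$ is $$|g|_{\alpha;gH}:=\sup_{\rho>0}\frac{1}{\rho^{\alpha}}\int_D (osc_\rho g)(x)\,\mathrm{d}\mu(x).$$ In the claim this is applied to $g=osc_r f$ (which is real-valued since $f$ is bounded). *)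

(* Defs.v *)
From HB Require Import structures.
From mathcomp Require Import all_boot all_order all_algebra.
From mathcomp Require Import all_classical all_reals all_analysis.
Set Implicit Arguments. Unset Strict Implicit. Unset Printing Implicit Defensive.
Import Order.TTheory GRing.Theory Num.Theory.
Local Open Scope classical_set_scope.
Local Open Scope ring_scope.

Definition Rd (R : realType) (d : nat) : measurableType _ :=
  d.-tuple (measurableTypeR R).

Definition coord {R : realType} {d : nat} (x : Rd R d) (i : 'I_d) : R := tnth x i.

Definition box {R : realType} {d : nat} (a b : 'I_d -> R) : set (Rd R d) :=
  [set x | forall i, a i <= coord x i < b i].

(* elementary volume: volume of a box (0 for the empty set),
   +oo for sets that are not boxes *)
Definition boxvol {R : realType} {d : nat} (A : set (Rd R d)) : \bar R :=
  if `[< A = set0 >] then 0%E else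
  ereal_inf [set ((\prod_(i < d) (ab.2 i - ab.1 i))%:E)%E
            | ab in [set ab : ('I_d -> R) * ('I_d -> R) |
                       (forall i, ab.1 i <= ab.2 i) /\ A = box ab.1 ab.2]].

Lemma boxvol0 {R : realType} {d : nat} : boxvol (set0 : set (Rd R d)) = 0%E.
Proof. by rewrite /boxvol asboolT. Qed.

Lemma boxvol_ge0 {R : realType} {d : nat} (A : set (Rd R d)) : (0 <= boxvol A)%E.
Proof.
rewrite /boxvol; case: ifP => // _.
apply: le_ereal_inf_tmp => _ [ab [hab _] <-].
rewrite lee_fin; apply: prodr_ge0 => i _; by rewrite subr_ge0.
Qed.

Definition leb_outer (R : realType) (d : nat) : set (Rd R d) -> \bar R :=
  mu_ext boxvol.
Arguments leb_outer : clear implicits.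

HB.instance Definition _ (R : realType) (d : nat) :=
  isOuterMeasure.Build R (Rd R d) (leb_outer R d)
    (@mu_ext0 _ _ _ boxvol boxvol0 boxvol_ge0) (@mu_ext_ge0 _ _ _ boxvol boxvol_ge0)
    (@le_mu_ext _ _ _ boxvol) (@mu_ext_sigma_subadditive _ _ _ boxvol boxvol_ge0).

(* R^d with the sigma-algebra of Lebesgue measurable sets (Caratheodory
   measurable sets of the Lebesgue outer measure) *)
Definition LRd (R : realType) (d : nat) := caratheodory_type (leb_outer R d).

Definition lebesgue_d (R : realType) (d : nat) : set (LRd R d) -> \bar R :=
  leb_outer R d.
Arguments lebesgue_d : clear implicits.

HB.instance Definition _ (R : realType) (d : nat) :=
  isMeasure.Build _ _ _ (lebesgue_d R d)
    (@caratheodory_measure0 R (Rd R d) (leb_outer R d))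
    (@caratheodory_measure_ge0 R (Rd R d) (leb_outer R d))
    (@caratheodory_measure_sigma_additive R (Rd R d) (leb_outer R d)).

Definition lcoord {R : realType} {d : nat} (x : LRd R d) (i : 'I_d) : R := tnth x i.

Definition eball {R : realType} {d : nat} (x : LRd R d) (r : R) : set (LRd R d) :=
  [set y | Num.sqrt (\sum_(i < d) (lcoord y i - lcoord x i) ^+ 2) < r].

Definition conv_hull {R : realType} {d : nat} (D : set (LRd R d)) : set (LRd R d) :=
  [set x | exists (n : nat) (p : 'I_n -> LRd R d) (w : 'I_n -> R),
     [/\ forall k, 0 <= w k, \sum_(k < n) w k = 1, forall k, D (p k) &
         forall i, lcoord x i = \sum_(k < n) w k * lcoord (p k) i]].

Local Open Scope ereal_scope.

Definition esupD {T} {R : realType} (D : set T) (g : T -> R) : \bar R :=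
  ereal_sup [set (g y)%:E | y in D].
Definition einfD {T} {R : realType} (D : set T) (g : T -> R) : \bar R :=
  ereal_inf [set (g y)%:E | y in D].

Definition osc {R : realType} {d : nat} (D : set (LRd R d)) (rho : R)
  (g : LRd R d -> R) (x : LRd R d) : \bar R :=
  esupD (eball x rho `&` D) g - einfD (eball x rho `&` D) g.

Definition gH_seminorm {R : realType} {d : nat}
  (mu : {measure set (LRd R d) -> \bar R}) (D : set (LRd R d)) (alpha : R)
  (g : LRd R d -> R) : \bar R :=
  ereal_sup [set ((rho `^ alpha)^-1)%:E * \int[mu]_(x in D) osc D rho g x
            | rho in [set rho : R | (0 < rho)%R]].

(* Main.v *)
(**
Write mu^* for Lebesgue outer measure, K = Conv(D) and A_s for the union of the
open balls of radius s centred in A.  For A included in D and l in ]0, 1],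

  l^d mu^*(K n A_s) <= mu^*(K n A_(l s)) .

When A is finite, split along the Voronoi cells of A: in the cell of a, A_s is
the ball B_s(a), and the homothety of ratio l centred at a preserves both the
cell and K, multiplying outer measure by l^d.  A general A is reached through a
countable dense subset.  Taking l = (r - rho)/(r + rho), Bernoulli's inequality
gives mu^*(K n (A_(r+rho) \ A_(r-rho))) <= 2 d (rho/r) mu^*(K).

For y within rho of x, the supremum of f over B_r(y) lies between those over
B_(r-rho)(x) and B_(r+rho)(x), and likewise for infima, i.e. for -f.  Cutting
the range of f into N >= r/rho levels, the difference of the two suprema is at
most (M/N)(1 + the number of levels t such that x lies in the shell
A_(r+rho) \ A_(r-rho) of A = {f > t}), where M = sup f - inf f.  Integrating,
the error 1 costs M rho/r and the shells cost M * 2d rho/r, whence the constant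
2d + 1.  If (2d+1) rho >= r, the bound by M suffices.

Outer measure is used because K is not known to be measurable.
*)
Require Import Defs.
From HB Require Import structures.
From mathcomp Require Import all_boot all_order all_algebra.
From mathcomp Require Import all_classical all_reals all_analysis.
From mathcomp Require Import measurable_realfun ring lra.
Import Order.TTheory GRing.Theory Num.Theory.
Local Open Scope classical_set_scope.
Local Open Scope ring_scope.

(** * Lebesgue outer measure under homotheties, and measurability of half-spaces *)

Section lebesgue_outer_measure.
Context {R : realType} {d : nat}.
Implicit Types (a b : 'I_d -> R) (A S T X : set (Rd R d)) (p x y : Rd R d).

Lemma boxvol_box_le a b : (forall i, a i <= b i) ->
  (boxvol (box a b) <= (\prod_(i < d) (b i - a i))%:E)%E.
Proof.
move=> ab; rewrite /boxvol; case: ifP => _.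
  by rewrite lee_fin prodr_ge0// => i _; rewrite subr_ge0.
by apply: ereal_inf_lbound; exists (a, b).
Qed.

Definition homothety p (l : R) x : Rd R d :=
  [tuple Defs.coord p i + l * (Defs.coord x i - Defs.coord p i) | i < d].

Lemma coord_homothety p l x i :
  Defs.coord (homothety p l x) i = Defs.coord p i + l * (Defs.coord x i - Defs.coord p i).
Proof. by rewrite /Defs.coord tnth_mktuple. Qed.

Lemma homothety_preimage_box p l a b : 0 < l ->
  homothety p l @^-1` box a b =
  box (fun i => Defs.coord p i + (a i - Defs.coord p i) / l)
      (fun i => Defs.coord p i + (b i - Defs.coord p i) / l).
Proof.
move=> l0; apply/seteqP; split=> x /= h i; have := h i;
  rewrite coord_homothety => /andP[h1 h2].
  by rewrite -lerBrDl ler_pdivrMr// -ltrBlDl ltr_pdivlMr//; apply/andP; split; lra.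
move: h1 h2; rewrite -lerBrDl ler_pdivrMr// -ltrBlDl ltr_pdivlMr// => h1 h2.
by apply/andP; split; lra.
Qed.

(** [mu_ext] ranges over covers by measurable sets; this keeps a cover admissible when it is pulled
    back along a homothety. *)
Lemma measurable_homothety p l : measurable_fun setT (homothety p l).
Proof.
apply/measurable_fun_tnthP => i.
rewrite (_ : _ \o _ = fun x : Rd R d =>
  Defs.coord p i + l * (Defs.coord x i - Defs.coord p i)); last first.
  by apply/funext => x; exact: coord_homothety.
apply: measurable_funD => //; apply: measurable_funM => //.
apply: measurable_funB => //.
exact: (@measurable_tnth _ (measurableTypeR R) d i).
Qed.

(** The preimage of a box has its sides divided by [l]; if [A] is neither empty nor a box, the right
    side is [+oo]. *)
Lemma boxvol_homothety p l A : 0 < l ->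
  ((l ^+ d)%:E * boxvol (homothety p l @^-1` A) <= boxvol A)%E.
Proof.
move=> l0; have [->|A0] := eqVneq A set0.
  by rewrite preimage_set0 !boxvol0 mule0.
rewrite [leRHS]/boxvol asboolF; last exact/eqP.
apply: le_ereal_inf_tmp => _ [[a b] /= [ab ->] <-].
rewrite homothety_preimage_box//.
apply: (@le_trans _ _ ((l ^+ d)%:E * (\prod_(i < d) ((b i - a i) / l))%:E)%E).
  apply: lee_wpmul2l; first by rewrite lee_fin exprn_ge0// ltW.
  rewrite (eq_bigr (fun i => (Defs.coord p i + (b i - Defs.coord p i) / l) -
    (Defs.coord p i + (a i - Defs.coord p i) / l))); last by move=> i _; ring.
  apply: boxvol_box_le => i.
  by rewrite lerD2l ler_pM2r ?invr_gt0// lerD2r.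
rewrite -EFinM lee_fin big_split/= prodr_const card_ord exprVn mulrCA.
by rewrite divff ?mulr1// expf_neq0// gt_eqF.
Qed.

Lemma leb_outer_homothety p l S T : 0 < l ->
  (forall x, S x -> T (homothety p l x)) ->
  ((l ^+ d)%:E * leb_outer R d S <= leb_outer R d T)%E.
Proof.
move=> l0 ST; apply: le_ereal_inf_tmp => _ [F [mF TF] <-].
have ld0 : (0 <= (l ^+ d)%:E)%E by rewrite lee_fin exprn_ge0// ltW.
apply: (@le_trans _ _ ((l ^+ d)%:E *
    \sum_(k <oo) boxvol (homothety p l @^-1` F k)))%E.
  apply: lee_wpmul2l => //.
  apply: ereal_inf_lbound; exists (fun k => homothety p l @^-1` F k) => //.
  split=> [k|x /ST/TF[k _ Fk]]; last by exists k.
  rewrite -[X in measurable X]setTI.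
  exact: measurable_homothety.
rewrite -nneseriesZl; last by move=> *; exact: boxvol_ge0.
apply: lee_nneseries => [k _ _|k _]; last exact: boxvol_homothety.
by rewrite mule_ge0// boxvol_ge0.
Qed.

Lemma boxvol_halfspace (i : 'I_d) t A :
  (boxvol (A `&` [set x | (Defs.coord x i < t)%R]) +
   boxvol (A `&` ~` [set x | (Defs.coord x i < t)%R]) <= boxvol A)%E.
Proof.
have [->|A0] := eqVneq A set0; first by rewrite !set0I boxvol0 adde0.
rewrite [leRHS]/boxvol asboolF; last exact/eqP.
apply: le_ereal_inf_tmp => _ [[a b] /= [ab ->] <-].
(* [m] is [t] clamped to [[a i, b i]], so both halves keep ordered bounds even when the hyperplane
   misses the box. *)
pose m := Num.max (a i) (Num.min (b i) t).
pose b' j := if j == i then m else b j.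
pose a' j := if j == i then m else a j.
have abi := ab i.
have am : a i <= m by rewrite /m le_max lexx.
have mb : m <= b i by rewrite /m ge_max abi ge_min lexx.
have -> : box a b `&` [set x | Defs.coord x i < t] = box a b'.
  apply/seteqP; split=> x /=.
    move=> [h xt] j; have := h j; rewrite /b'; case: eqVneq => [->|//].
    by rewrite /Defs.coord /m => /andP[-> xb] /=; rewrite lt_max lt_min xb xt orbT.
  move=> h; split=> [j|].
    have := h j; rewrite /b'; case: eqVneq => [->|//].
    by move=> /andP[-> /lt_le_trans]; exact.
  have := h i; rewrite /b' eqxx /Defs.coord  => /andP[ax].
  by rewrite /m lt_max lt_min ltNge ax /= => /andP[].
have -> : box a b `&` ~` [set x | Defs.coord x i < t] = box a' b.
  apply/seteqP; split=> x /=.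
    move=> [h /negP]; rewrite -leNgt => xt j; have := h j; rewrite /a'.
    case: eqVneq => [->|//]; rewrite /Defs.coord => /andP[ax ->].
    by rewrite /m ge_max ax ge_min xt orbT.
  move=> h; split=> [j|].
    have := h j; rewrite /a'; case: eqVneq => [->|//].
    by move=> /andP[/(le_trans am) -> ->].
  have := h i; rewrite /a' eqxx /Defs.coord => /andP[].
  rewrite /m ge_max ge_min => /andP[_ /orP[bx xb|tx _]].
    by move: (le_lt_trans bx xb); rewrite ltxx.
  by apply/negP; rewrite -leNgt.
apply: (@le_trans _ _ ((\prod_(j < d) (b' j - a j))%:E +
                       (\prod_(j < d) (b j - a' j))%:E)%E).
  by apply: leeD; apply: boxvol_box_le => j; rewrite /b' /a'; case: eqVneq => [->|_].
rewrite -EFinD lee_fin (bigD1 i)//= [X in _ + X <= _](bigD1 i)//= [leRHS](bigD1 i)//=.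
have e1 : \prod_(j < d | j != i) (b' j - a j) = \prod_(j < d | j != i) (b j - a j).
  by apply: eq_bigr => j /negPf; rewrite /b' => ->.
have e2 : \prod_(j < d | j != i) (b j - a' j) = \prod_(j < d | j != i) (b j - a j).
  by apply: eq_bigr => j /negPf; rewrite /a' => ->.
have -> : b i - a i = m - a i + (b i - m) by ring.
by rewrite e1 e2 /a' /b' eqxx [leRHS]mulrDl.
Qed.

(** Cutting each member of a cover of [X] by the hyperplane does not raise the total volume, which
    is the Caratheodory criterion. Measurability of coordinates, balls and Voronoi cells rests on
    this. *)
Lemma measurable_halfspace (i : 'I_d) t :
  measurable ([set x | lcoord x i < t] : set (LRd R d)).
Proof.
apply: (@le_caratheodory_measurable R (Rd R d) (leb_outer R d)) => X.
apply: le_ereal_inf_tmp => _ [F [mF XF] <-].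
have mH : measurable ([set x : Rd R d | Defs.coord x i < t]).
  rewrite (_ : [set _ | _] =
    (fun x : Rd R d => Defs.coord x i) @^-1` `]-oo, t[%classic); last first.
    by apply/seteqP; split=> x /=; rewrite in_itv.
  rewrite -[X in measurable X]setTI.
  exact: (@measurable_tnth _ (measurableTypeR R) d i).
have sub (B : set (Rd R d)) : measurable B ->
    (leb_outer R d (X `&` B) <= \sum_(k <oo) boxvol (F k `&` B))%E.
  move=> mB; apply: ereal_inf_lbound; exists (fun k => F k `&` B) => //.
  split=> [k|x [/XF[k _ Fk] Bx]]; last by exists k.
  exact: measurableI.
apply: (le_trans (leeD (sub _ mH) (sub _ (measurableC mH)))).
rewrite -nneseriesD; try by move=> *; exact: boxvol_ge0.
apply: lee_nneseries => [k _ _|k _]; last exact: boxvol_halfspace.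
by rewrite adde_ge0// boxvol_ge0.
Qed.

Lemma measurable_lcoord (i : 'I_d) :
  measurable_fun setT (fun x : LRd R d => lcoord x i).
Proof.
apply: (measurability _ (RGenInftyO.measurableE R)) => //.
move=> _ [_ [t ->] <-]; rewrite setTI.
rewrite (_ : _ @^-1` _ = [set x | lcoord x i < t]); last first.
  by apply/seteqP; split=> x /=; rewrite in_itv.
exact: measurable_halfspace.
Qed.

End lebesgue_outer_measure.

(** * Euclidean distance, open balls and contractions *)

Section euclidean_distance.
Context {R : realType} {d : nat}.
Implicit Types (p q x y z : LRd R d) (a : nat -> LRd R d) (l s : R).

Definition sqdist x y : R := \sum_(i < d) (lcoord x i - lcoord y i) ^+ 2.

Definition eudist x y : R := Num.sqrt (sqdist x y).

Lemma sqdist_ge0 x y : 0 <= sqdist x y.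
Proof. by apply: sumr_ge0 => i _; exact: sqr_ge0. Qed.

Lemma eudist_ge0 x y : 0 <= eudist x y.
Proof. exact: sqrtr_ge0. Qed.

Lemma eudistxx x : eudist x x = 0.
Proof.
rewrite /eudist /sqdist big1 ?sqrtr0// => i _.
by rewrite subrr expr0n.
Qed.

Lemma eudistC x y : eudist x y = eudist y x.
Proof. by congr Num.sqrt; apply: eq_bigr => i _; rewrite -sqrrN opprB. Qed.

(** The sum of the squares of [B u - C v] equals [B (A B - C^2)], which settles [B > 0]; and [B = 0]
    forces [v = 0]. *)
Lemma Cauchy_Schwarz (u v : 'I_d -> R) :
  (\sum_(i < d) u i * v i) ^+ 2 <=
  (\sum_(i < d) u i ^+ 2) * (\sum_(i < d) v i ^+ 2).
Proof.
set A := \sum_(i < d) u i ^+ 2; set B := \sum_(i < d) v i ^+ 2.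
set C := \sum_(i < d) u i * v i.
have B0 : 0 <= B by apply: sumr_ge0 => i _; exact: sqr_ge0.
have [Bgt|Ble] := ltP 0 B.
  have : 0 <= \sum_(i < d) (B * u i - C * v i) ^+ 2.
    by apply: sumr_ge0 => i _; exact: sqr_ge0.
  have -> : \sum_(i < d) (B * u i - C * v i) ^+ 2 =
      B ^+ 2 * A - 2 * B * C * C + C ^+ 2 * B.
    have -> : B ^+ 2 * A = \sum_(i < d) B ^+ 2 * u i ^+ 2 by rewrite -mulr_sumr.
    have -> : 2 * B * C * C = \sum_(i < d) 2 * B * C * (u i * v i) by rewrite -mulr_sumr.
    have -> : C ^+ 2 * B = \sum_(i < d) C ^+ 2 * v i ^+ 2 by rewrite -mulr_sumr.
    rewrite -sumrB -big_split/=.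
    by apply: eq_bigr => i _; ring.
  have -> : B ^+ 2 * A - 2 * B * C * C + C ^+ 2 * B = B * (A * B - C ^+ 2) by ring.
  by rewrite pmulr_rge0// subr_ge0.
have /eqP : B = 0 by apply/eqP; rewrite eq_le Ble B0.
rewrite psumr_eq0; last by move=> i _; exact: sqr_ge0.
move=> /allP v0.
have -> : C = 0.
  rewrite /C big1// => i _.
  have := v0 i (mem_index_enum i); rewrite /= sqrf_eq0 => /eqP ->.
  by rewrite mulr0.
by rewrite expr0n mulr_ge0// sumr_ge0// => i _; exact: sqr_ge0.
Qed.

Lemma eudist_triangle x y z : eudist x z <= eudist x y + eudist y z.
Proof.
have h0 : 0 <= eudist x y + eudist y z by rewrite addr_ge0// eudist_ge0.
rewrite -(ler_pXn2r (n := 2))// ?nnegrE ?eudist_ge0//.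
rewrite sqrrD !sqr_sqrtr ?sqdist_ge0//.
rewrite -sqrtrM ?sqdist_ge0//.
pose u i := lcoord x i - lcoord y i; pose v i := lcoord y i - lcoord z i.
have -> : sqdist x z = sqdist x y + (\sum_(i < d) u i * v i) *+ 2 + sqdist y z.
  rewrite /sqdist -mulr_natr mulr_suml -!big_split/=.
  by apply: eq_bigr => i _; rewrite /u /v; ring.
rewrite lerD2r lerD2l lerMn2r/=.
apply: le_trans (ler_norm _) _.
by rewrite -sqrtr_sqr ler_wsqrtr// Cauchy_Schwarz.
Qed.

Lemma eballE x s y : eball x s y = (eudist y x < s) :> Prop.
Proof. by []. Qed.

Lemma eball_subset x y s t : eudist x y + s <= t -> eball x s `<=` eball y t.
Proof.
move=> st z; rewrite !eballE => zs.
apply: le_lt_trans (eudist_triangle z x y) _.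
by apply: lt_le_trans st; rewrite addrC ltrD2l.
Qed.

Lemma eudist_le_coord x y s : (1 <= d)%N ->
  (forall i, `|lcoord x i - lcoord y i| <= s) -> eudist x y <= d%:R * s.
Proof.
move=> d1 xys.
have s0 : 0 <= s by exact: le_trans (xys (Ordinal d1)).
rewrite -(ler_pXn2r (n := 2))// ?nnegrE ?eudist_ge0// ?mulr_ge0//.
rewrite sqr_sqrtr ?sqdist_ge0//.
apply: (@le_trans _ _ (\sum_(i < d) s ^+ 2)).
  by apply: ler_sum => i _; rewrite -real_normK ?num_real// ler_pXn2r// nnegrE.
rewrite sumr_const card_ord -[leLHS]mulr_natl exprMn.
by rewrite ler_wpM2r ?sqr_ge0// expr2 ler_peMr// ler1n.
Qed.

Lemma lcoord_homothety p l x i :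
  lcoord (homothety p l x : LRd R d) i = lcoord p i + l * (lcoord x i - lcoord p i).
Proof. exact: coord_homothety. Qed.

Lemma eudist_homothety p l x : 0 <= l -> eudist (homothety p l x) p = l * eudist x p.
Proof.
move=> l0; have {2}-> : l = Num.sqrt (l ^+ 2) by rewrite sqrtr_sqr ger0_norm.
rewrite /eudist -sqrtrM ?sqr_ge0//; congr Num.sqrt.
rewrite /sqdist mulr_sumr; apply: eq_bigr => i _.
by rewrite lcoord_homothety; ring.
Qed.

(** The difference of the squared distances to [q] and to [p] is affine, so along the segment from
    [p] to [x] it interpolates between its values at the two ends. *)
Lemma sqdist_homothety p q l x :
  sqdist (homothety p l x) q - sqdist (homothety p l x) p =
  l * (sqdist x q - sqdist x p) + (1 - l) * sqdist q p.
Proof.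
rewrite /sqdist -!sumrB !mulr_sumr -big_split/=; apply: eq_bigr => i _.
by rewrite lcoord_homothety; ring.
Qed.

Lemma measurable_sqdist p : measurable_fun setT (fun x => sqdist x p).
Proof.
rewrite /sqdist; apply: (@measurable_sum _ _ R setT _ _
  (fun (i : 'I_d) x => (lcoord x i - lcoord p i) ^+ 2)) => i.
apply: (@measurable_funX _ _ R setT (fun x => lcoord x i - lcoord p i) 2).
apply: (@measurable_funB _ _ R setT (fun x => lcoord x i) (cst (lcoord p i))).
  exact: measurable_lcoord.
exact: measurable_cst.
Qed.

Lemma eball_sqdist p s : 0 < s -> eball p s = [set x | sqdist x p < s ^+ 2].
Proof.
move=> s0; apply/seteqP; split=> x /=; rewrite ?eballE /eudist.
  move=> xs; rewrite -(sqr_sqrtr (sqdist_ge0 x p)).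
  by rewrite ltr_pXn2r// nnegrE// ?sqrtr_ge0// ltW.
move=> xs; rewrite -(ltr_pXn2r (n := 2))// ?nnegrE ?sqrtr_ge0//; last exact: ltW.
by rewrite sqr_sqrtr// sqdist_ge0.
Qed.

Lemma measurable_lt_fun (f g : LRd R d -> R) :
  measurable_fun setT f -> measurable_fun setT g ->
  measurable [set x | f x < g x].
Proof.
move=> mf mg.
have mfg := measurable_fun_ltr mf mg.
have := mfg measurableT [set true] I; rewrite setTI.
by congr measurable; apply/seteqP; split.
Qed.

Lemma measurable_eball p s : 0 < s -> measurable (eball p s).
Proof.
move=> s0; rewrite eball_sqdist//.
apply: (measurable_lt_fun (sqdist^~ p) (cst (s ^+ 2))).
  exact: measurable_sqdist.
exact: measurable_cst.
Qed.

(** * Voronoi cells and the contraction of a finite union of balls *)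

(* Ties are broken towards the smallest index, which makes the cells disjoint. *)
Definition voronoi a n k : set (LRd R d) :=
  [set x | (k < n)%N /\ forall j, (j < n)%N ->
    sqdist x (a k) <= sqdist x (a j) /\
    ((j < k)%N -> sqdist x (a k) < sqdist x (a j))].

Lemma trivIset_voronoi a n : trivIset setT (voronoi a n).
Proof.
apply/trivIsetP => i j _ _; wlog ij : i j / (i < j)%N => [h|_].
  rewrite neq_ltn => /orP[ij|ji]; first by apply: h => //; rewrite neq_ltn ij.
  by rewrite setIC; apply: h => //; rewrite neq_ltn ji.
apply/seteqP; split=> x //= [[i_n /(_ j) hi] [jn /(_ _ i_n)[_ /(_ ij)]]].
by rewrite ltNge (hi jn).1.
Qed.

Lemma measurable_voronoi a n k : measurable (voronoi a n k).
Proof.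
have [kn|kn] := boolP (k < n)%N; last first.
  rewrite (_ : voronoi _ _ _ = set0)//; apply/seteqP; split=> x // [].
  by rewrite (negPf kn).
rewrite (_ : voronoi a n k = \bigcap_(j in `I_n)
   (~` [set x | sqdist x (a j) < sqdist x (a k)] `&`
    (if (j < k)%N then [set x | sqdist x (a k) < sqdist x (a j)] else setT))).
  apply: fin_bigcap_measurable => [|j _]; first exact: finite_II.
  apply: measurableI.
    apply: measurableC.
    by apply: measurable_lt_fun; exact: measurable_sqdist.
  by case: ifP => // _; apply: measurable_lt_fun; exact: measurable_sqdist.
apply/seteqP; split=> x /=.
  move=> [_ h] j /= jn; have [h1 h2] := h j jn; split.
    by apply/negP; rewrite -leNgt.
  by case: ifP.
move=> h; split=> // j jn; have /= [/negP h1 h2] := h j jn; split.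
  by rewrite leNgt.
by move: h2; case: ifP.
Qed.

(** Induction on the number of centres: a new centre takes over [x] only when it is strictly closer,
    in accordance with the tie rule. *)
Lemma voronoi_cover a n x : exists2 k, (k < n.+1)%N & voronoi a n.+1 k x.
Proof.
elim: n => [|n [k kn [_ h]]].
  exists 0%N => //; split=> // -[|//] _; split=> //.
have [lt|le] := ltP (sqdist x (a n.+1)) (sqdist x (a k)).
  exists n.+1 => //; split=> // j; rewrite ltnS leq_eqVlt => /predU1P[->|jn].
    by split=> //; rewrite ltnn.
  have := lt_le_trans lt (h j jn).1.
  by split=> //; exact: ltW.
exists k; first by rewrite ltnS ltnW.
split=> [|j]; first by rewrite ltnS ltnW.
rewrite ltnS leq_eqVlt => /predU1P[->|]; last exact: h.
by split=> // nk; move: (ltn_trans nk kn); rewrite ltnn.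
Qed.

(** By [sqdist_homothety] the new gap is [l] times the old one plus a nonnegative term, so weak and
    strict inequalities both survive. *)
Lemma voronoi_homothety a n k l x : 0 < l <= 1 ->
  voronoi a n k x -> voronoi a n k (homothety (a k) l x).
Proof.
move=> /andP[l0 l1] [kn h]; split=> // j jn.
have [h1 h2] := h j jn.
have e0 : 0 <= (1 - l) * sqdist (a j) (a k).
  by rewrite mulr_ge0 ?sqdist_ge0// subr_ge0.
split=> [|jk].
  by rewrite -subr_ge0 sqdist_homothety addr_ge0// mulr_ge0 ?subr_ge0// ltW.
by rewrite -subr_gt0 sqdist_homothety ltr_wpDr// mulr_gt0// subr_gt0 h2.
Qed.

Lemma leb_outer_shrink_balls (C : set (LRd R d)) a n l s : 0 < l <= 1 ->
  (forall k x, C x -> C (homothety (a k) l x)) ->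
  ((l ^+ d)%:E * leb_outer R d (C `&` \bigcup_(k < n) eball (a k) s) <=
   leb_outer R d (C `&` \bigcup_(k < n) eball (a k) (l * s)))%E.
Proof.
move=> l01 CC; have /andP[l0 l1] := l01.
have ld0 : (0 <= (l ^+ d)%:E)%E by rewrite lee_fin exprn_ge0// ltW.
case: n => [|n].
  rewrite !bigcup_mkord !big_ord0 setI0.
  have -> : leb_outer R d set0 = 0%E by exact: (outer_measure0 (leb_outer R d)).
  by rewrite mule0.
set F := \bigcup_(k < n.+1) eball (a k) s.
set E := \bigcup_(k < n.+1) eball (a k) (l * s).
pose V := voronoi a n.+1.
(* Additivity over measurable disjoint cells holds on an arbitrary set [X], so [C] may be
   non-measurable. *)
have additive X := caratheodory_additive (mu := leb_outer R d)
  (measurable_voronoi a n.+1) (trivIset_voronoi a n.+1) n.+1 X.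
have -> : C `&` F = (C `&` F) `&` \big[setU/set0]_(k < n.+1) V k.
  apply/esym/setIidPl => x _; have [k kn Vx] := voronoi_cover a n x.
  by rewrite -bigcup_mkord; exists k.
apply: (@le_trans _ _ (leb_outer R d ((C `&` E) `&` \big[setU/set0]_(k < n.+1) V k))).
  rewrite !additive ge0_sume_distrr; last by move=> i _; exact: outer_measure_ge0.
  apply: lee_sum => k _.
  apply: (leb_outer_homothety (a k)) => // x [[Cx [j jn xj]] Vx].
  split; last exact: voronoi_homothety.
  split; first exact: CC.
  (* The image is placed in the ball of [a k] itself: [x] is in the ball of some [a j], and its cell
     makes [a k] at least as close. *)
  exists k; first exact: (ltn_ord k).
  rewrite eballE eudist_homothety ?ltr_pM2l//; last exact: ltW.
  apply: le_lt_trans xj; rewrite ler_wsqrtr//.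
  by have [_ /(_ j jn)[]] := Vx.
apply: (@le_outer_measure _ _ (leb_outer R d)).
exact: subIsetl.
Qed.

End euclidean_distance.

(** * Convex hulls, dense sequences and the measure of shells *)

Section spherical_shells.
Context {R : realType} {d : nat}.
Implicit Types (A D : set (LRd R d)) (p q x y z : LRd R d) (l s : R).

Lemma sub_conv_hull D : D `<=` conv_hull D.
Proof.
move=> x Dx; exists 1%N, (fun=> x), (fun=> 1); split=> // [|i].
  by rewrite big_ord1.
by rewrite big_ord1 mul1r.
Qed.

(** The point [p] joins the convex combination as index 0 with weight [1 - l], the other weights
    being scaled by [l]. *)
Lemma conv_hull_homothety D p l x : 0 <= l <= 1 -> D p ->
  conv_hull D x -> conv_hull D (homothety p l x).
Proof.
move=> /andP[l0 l1] Dp [n [a [w [w0 w1 Da xE]]]].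
exists n.+1, (fun k => oapp a p (unlift ord0 k)),
  (fun k => oapp (fun j => l * w j) (1 - l) (unlift ord0 k)); split.
- by move=> k; case: unliftP => [j|] _ /=; rewrite ?mulr_ge0// subr_ge0.
- rewrite big_ord_recl unlift_none/=.
  under eq_bigr do rewrite liftK/=.
  by rewrite -mulr_sumr w1 mulr1 subrK.
- by move=> k; case: unliftP => [j|] _ //=.
- move=> i; rewrite big_ord_recl unlift_none/=.
  under eq_bigr do rewrite liftK/= -mulrA.
  by rewrite -mulr_sumr -xE lcoord_homothety; ring.
Qed.

Lemma rational_approximation (e : R) p : (1 <= d)%N -> 0 < e ->
  exists q : d.-tuple rat, eudist p [tuple ratr (tnth q i) | i < d] < e.
Proof.
move=> d1 e0.
have d0 : 0 < (d%:R : R) by rewrite ltr0n.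
pose t := e / (2 * d%:R).
have t0 : 0 < t by rewrite divr_gt0// mulr_gt0.
have /choice[q hq] (i : 'I_d) : exists u : rat, `|lcoord p i - ratr u| <= t.
  have [u] := rat_in_itvoo (ltr_pwDr t0 (lexx (lcoord p i))).
  rewrite in_itv/= => /andP[pu ut]; exists u.
  by rewrite distrC ger0_norm ?subr_ge0 ?ltW// ltrBlDl.
exists [tuple q i | i < d].
apply: (@le_lt_trans _ _ (d%:R * t)).
  apply: eudist_le_coord => // i.
  by rewrite /lcoord !tnth_mktuple; exact: hq.
have -> : d%:R * t = e / 2 by rewrite /t; field; rewrite gt_eqF.
lra.
Qed.

(** Balls are open, so a centre in [A] can be moved slightly to a term of a dense sequence without
    changing the radius. *)
Lemma dense_sequence A : (1 <= d)%N -> A !=set0 ->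
  exists a : nat -> LRd R d, (forall n, A (a n)) /\
    forall p s x, A p -> eball p s x -> exists n, eball (a n) s x.
Proof.
move=> d1 [p0 Ap0].
(* When [n] codes [(m, q)], [y] must be within [1/(m+1)] of the rational point [q] if [A] has such a
   point; otherwise any point of [A], such as [p0], will do. *)
pose P n y := A y /\ forall m (q : d.-tuple rat), unpickle n = Some (m, q) ->
  (exists2 z, A z & eudist z [tuple ratr (tnth q i) | i < d] < m.+1%:R^-1) ->
  eudist y [tuple ratr (tnth q i) | i < d] < m.+1%:R^-1.
have /choice[a ha] n : exists y, P n y.
  case E : (unpickle n : option (nat * d.-tuple rat)) => [[m q]|]; last first.
    by exists p0; split=> // m q; rewrite E.
  have [[z Az zq]|nz] := pselect (exists2 z, A z &
    eudist z [tuple ratr (tnth q i) | i < d] < m.+1%:R^-1).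
    by exists z; split=> // m' q'; rewrite E => -[<- <-].
  by exists p0; split=> // m' q'; rewrite E => -[<- <-].
exists a; split=> [n|p s x Ap]; first by have [] := ha n.
rewrite eballE => xp.
(* Half the slack of [x] in its ball: the hops from [p] to the rational point and on to the sequence
   cost less than [e] each. *)
pose e := (s - eudist x p) / 2.
have e0 : 0 < e by rewrite divr_gt0// subr_gt0.
pose m := Num.truncn e^-1.
have m0 : 0 < (m.+1%:R^-1 : R) by rewrite invr_gt0.
have me : m.+1%:R^-1 < e by rewrite invf_plt ?posrE//; exact: truncnS_gt.
have [q pq] := rational_approximation _ p d1 m0.
have [_ /(_ m q)] := ha (pickle (m, q)).
rewrite pickleK => /(_ erefl) H.
exists (pickle (m, q)); rewrite eballE.
have {}H := H (ex_intro2 _ _ p Ap pq).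
have t1 := eudist_triangle x p (a (pickle (m, q))).
have t2 := eudist_triangle p [tuple ratr (tnth q i) | i < d] (a (pickle (m, q))).
rewrite eudistC in H.
have eE : e * 2 = s - eudist x p by rewrite /e divfK.
have b1 := lt_trans H me; have b2 := lt_trans pq me.
apply: le_lt_trans t1 _; rewrite -ltrBrDl -eE mulr_natr mulr2n.
by apply: le_lt_trans t2 _; rewrite ltrD.
Qed.

Definition thicken A s : set (LRd R d) := \bigcup_(p in A) eball p s.

Lemma measurable_thicken A s : (1 <= d)%N -> 0 < s -> measurable (thicken A s).
Proof.
move=> d1 s0; have [->|/set0P A0] := eqVneq A set0.
  by rewrite /thicken bigcup_set0.
have [a [Aa ha]] := dense_sequence A d1 A0.
rewrite (_ : thicken A s = \bigcup_n eball (a n) s).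
  by apply: bigcupT_measurable => n; exact: measurable_eball.
apply/seteqP; split=> [x [p Ap /(ha _ _ _ Ap)[n xn]]|x [n _ xn]].
  by exists n.
by exists (a n).
Qed.

Lemma lebesgue_shell A D s1 s2 : (1 <= d)%N -> measurable D -> A `<=` D ->
  0 < s1 <= s2 -> (leb_outer R d (conv_hull D) < +oo)%E ->
  (lebesgue_d R d (D `&` (thicken A s2 `\` thicken A s1)) <=
   (1 - (s1 / s2) ^+ d)%:E * leb_outer R d (conv_hull D))%E.
Proof.
move=> d1 mD AD /andP[s10 s12] Koo.
have s20 : 0 < s2 by exact: lt_le_trans s12.
set K := conv_hull D; set l := s1 / s2.
have l0 : 0 < l by rewrite divr_gt0.
have l1 : l <= 1 by rewrite ler_pdivrMr// mul1r.
have ls : l * s2 = s1 by rewrite divfK// gt_eqF.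
have Lge0 := @outer_measure_ge0 _ _ (leb_outer R d).
have leL := @le_outer_measure _ _ (leb_outer R d).
have bound0 : (0 <= (1 - l ^+ d)%:E * leb_outer R d K)%E.
  apply: mule_ge0; last exact: Lge0.
  by rewrite lee_fin subr_ge0 exprn_ile1// ltW.
have [A0|/set0P A0] := eqVneq A set0.
  by rewrite A0 /thicken bigcup_set0 set0D setI0 measure0.
have [a [Aa ha]] := dense_sequence A d1 A0.
pose F n := \bigcup_(k < n) eball (a k) s2.
pose E n := \bigcup_(k < n) eball (a k) s1.
have mE n : measurable (E n).
  by apply: bigcup_measurable => k _; exact: measurable_eball.
have mF n : measurable (F n).
  by apply: bigcup_measurable => k _; exact: measurable_eball.
(* All of [thicken A s1] is removed, not just [E n], so that [W n] increases with [n]; intersecting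
   with [D] makes it measurable, as continuity from below requires. *)
pose W n := D `&` (F n `\` thicken A s1).
have mW n : measurable (W n).
  by apply: measurableI => //; apply: measurableD => //; exact: measurable_thicken.
have WE : D `&` (thicken A s2 `\` thicken A s1) = \bigcup_n W n.
  apply/seteqP; split=> [x [Dx [[p Ap xp] nx]]|x [n _ [Dx [[k _ xk] nx]]]].
    have [n xn] := ha _ _ _ Ap xp.
    by exists n.+1 => //; split=> //; split=> //; exists n => /=.
  by split=> //; split=> //; exists (a k).
have Wbound n : (lebesgue_d R d (W n) <= (1 - l ^+ d)%:E * leb_outer R d K)%E.
  have h := leb_outer_shrink_balls K a n l s2.
  rewrite ls l0 l1 in h.
  have {}h := h isT (fun k x => conv_hull_homothety D (a k) l x _ (AD _ (Aa k))).
  rewrite -/(F n) -/(E n) in h.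
  have EF : E n `<=` F n.
    move=> x [k kn xk]; exists k => //.
    by move: xk; rewrite !eballE => /lt_le_trans; apply.
  have fin X : leb_outer R d (K `&` X) \is a fin_num.
    rewrite ge0_fin_numE ?Lge0//; apply: le_lt_trans Koo.
    by apply: leL; exact: subIsetl.
  have finK : leb_outer R d K \is a fin_num by rewrite ge0_fin_numE ?Lge0.
  have split_F : leb_outer R d (K `&` F n) =
      (leb_outer R d (K `&` E n) + leb_outer R d (K `&` (F n `\` E n)))%E.
    have -> := mE n (K `&` F n).
    congr (leb_outer R d _ + leb_outer R d _)%E; last by rewrite setIA.
    by rewrite -setIA; congr (K `&` _); apply/setIidr.
  apply: (@le_trans _ _ (leb_outer R d (K `&` (F n `\` E n)))).
    apply: leL => x [Dx [Fx nx]]; split; first exact: sub_conv_hull.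
    split=> // -[k _ xk]; apply: nx; by exists (a k).
  have FK : (leb_outer R d (K `&` F n) <= leb_outer R d K)%E.
    by apply: leL; exact: subIsetl.
  move: h split_F FK.
  (* All terms are finite, so the bound becomes real arithmetic: the measure on the shell is that on
     [F n] less that on [E n], and the latter is at least [l^d] times the former. *)
  rewrite -(fineK (fin (F n))) -(fineK (fin (E n))) -(fineK (fin (F n `\` E n))).
  rewrite -(fineK finK) -!EFinM -EFinD !lee_fin => h [split_F] FK.
  have : (1 - l ^+ d) * fine (leb_outer R d (K `&` F n)) <=
         (1 - l ^+ d) * fine (leb_outer R d K).
    by rewrite ler_wpM2l// subr_ge0 exprn_ile1// ltW.
  by lra.
have ndW : nondecreasing_seq W.
  move=> m n mn; apply/subsetPset => x [Dx [[k km xk] nx]].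
  by split=> //; split=> //; exists k => //; exact: leq_trans mn.
have mUW : measurable (\bigcup_n W n) by exact: bigcupT_measurable.
have cvW := nondecreasing_cvg_mu (mu := lebesgue_d R d) mW mUW ndW.
rewrite WE -(cvg_lim _ cvW)//.
apply: lime_le; first by apply/cvg_ex; eexists; exact: cvW.
by apply: nearW => n /=; exact: Wbound.
Qed.

(** Bernoulli's inequality [1 - l^n <= n (1 - l)], where [1 - l = 2 rho / (r + rho)], followed by
    lowering the denominator to [r]. *)
Lemma Bernoulli_shell (r rho : R) : 0 < rho < r ->
  1 - ((r - rho) / (r + rho)) ^+ d <= 2 * d%:R * rho / r.
Proof.
move=> /andP[rho0 rhor].
have r0 : 0 < r by exact: lt_trans rhor.
set l := (r - rho) / (r + rho).
have l0 : 0 <= l by rewrite divr_ge0// ?subr_ge0 ltW// addr_gt0.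
have l1 : l <= 1 by rewrite ler_pdivrMr ?addr_gt0// mul1r; lra.
have H n : 1 - l ^+ n <= n%:R * (1 - l).
  elim: n => [|n ih]; first by rewrite expr0 subrr mul0r.
  rewrite exprS -natr1 mulrDl mul1r.
  have : l * (1 - l ^+ n) <= 1 - l ^+ n.
    by rewrite ler_piMl// subr_ge0 exprn_ile1.
  by move: ih; lra.
apply: le_trans (H d) _.
have -> : 2 * d%:R * rho / r = d%:R * (2 * rho / r) by ring.
apply: ler_wpM2l => //.
have -> : 1 - l = 2 * rho / (r + rho) by rewrite /l; field; rewrite gt_eqF ?addr_gt0.
rewrite ler_pM2l ?mulr_gt0// lef_pV2 ?posrE ?addr_gt0//.
by rewrite lerDl ltW.
Qed.

End spherical_shells.

(** * Integration of layers and counting of levels *)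

(* The oscillation is not shown to be measurable, so [ge0_le_integral] does not
   apply to it. *)
Lemma ge0_le_integral_nomeas {dT : measure_display} {T : measurableType dT}
    {R : realType} (mu : {measure set T -> \bar R}) (D : set T)
    (f g : T -> \bar R) :
  (forall x, D x -> 0 <= f x)%E -> (forall x, D x -> f x <= g x)%E ->
  (\int[mu]_(x in D) f x <= \int[mu]_(x in D) g x)%E.
Proof.
move=> f0 fg; rewrite !ge0_integralE//=; last first.
  by move=> x Dx; exact: le_trans (f0 x Dx) (fg x Dx).
apply: ereal_sup_le => _ [h /= hf <-]; exists h => // x /=.
apply: le_trans (hf x) _; rewrite /patch; case: ifPn => //.
by rewrite inE; exact: fg.
Qed.

Lemma integral_layers_le {dT : measure_display} {T : measurableType dT}
    {R : realType} (mu : {measure set T -> \bar R}) (D : set T)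
    (E : nat -> set T) (N : nat) (delta kappa b : R) :
  measurable D -> (forall k, measurable (E k)) -> 0 <= delta ->
  (mu D <= kappa%:E)%E -> (forall k, mu (E k `&` D) <= b%:E)%E ->
  (\int[mu]_(x in D) (delta * (1 + \sum_(k < N) \1_(E k) x))%:E <=
   (delta * (kappa + N%:R * b))%:E)%E.
Proof.
move=> mD mE d0 muD muE.
have mind k : measurable_fun D (fun x => (\1_(E k) x : R)%:E).
  by apply/measurable_EFinP; exact: measurable_indic.
under eq_integral do rewrite EFinM EFinD -sumEFin.
have s0 x : (0 <= \sum_(k < N) (\1_(E k) x : R)%:E)%E.
  by apply: sume_ge0 => k _; rewrite lee_fin.
have ms : measurable_fun D (fun x => \sum_(k < N) (\1_(E k) x : R)%:E)%E.
  exact: (@emeasurable_sum _ _ R D _ _ (fun (k : 'I_N) x => (\1_(E k) x : R)%:E)).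
rewrite ge0_integralZl_EFin//; last 2 first.
- by move=> x _; rewrite adde_ge0.
- exact: emeasurable_funD.
rewrite EFinM; apply: lee_wpmul2l; first by rewrite lee_fin.
rewrite ge0_integralD//.
rewrite [X in (X + _)%E](integral_cst mu mD) mul1e.
rewrite (ge0_integral_sum mu mD (f := fun (k : 'I_N) x => (\1_(E k) x : R)%:E))//.
rewrite EFinD; apply: leeD => //.
apply: (@le_trans _ _ (\sum_(k < N) b%:E)%E).
  by apply: lee_sum => k _; rewrite integral_indic.
by rewrite sumEFin sumr_const card_ord mulr_natl.
Qed.

(** The sum is the ceiling of [u] capped at [N]. The middle bound feeds the induction for the last
    one. *)
Lemma count_levels {R : realType} (N : nat) (u : R) : 0 <= u ->
  [/\ Num.min u N%:R <= \sum_(k < N) (k%:R < u)%R%:R :> R,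
      \sum_(k < N) (k%:R < u)%R%:R <= N%:R :> R &
      \sum_(k < N) (k%:R < u)%R%:R <= u + 1 :> R].
Proof.
move=> u0; elim: N => [|N [h1 h2 h3]].
  by rewrite big_ord0; split=> //; [rewrite ge_min lexx orbT|rewrite addr_ge0].
rewrite big_ord_recr/= -natr1; have [Nu|uN] := ltP N%:R u.
  move: h1; rewrite (min_idPr (ltW Nu)) => h1.
  split; first by rewrite ge_min lerD2r h1 orbT.
    by rewrite lerD2r.
  by rewrite lerD2r (le_trans h2)// ltW.
move: h1; rewrite (min_idPl uN) addr0 => h1; split=> //.
  by rewrite ge_min h1.
by rewrite (le_trans h2)// lerDl.
Qed.

Lemma normr_itv_le {R : realDomainType} (a b z : R) :
  a <= z <= b -> `|z| <= `|a| + `|b|.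
Proof.
move=> /andP[az zb]; rewrite ler_norml lerNl; apply/andP; split.
  rewrite (le_trans _ (_ : `|a| <= _)) ?lerDl//.
  by rewrite (le_trans (_ : - z <= - a)) ?lerN2// -normrN ler_norm.
by rewrite (le_trans zb)// (le_trans (ler_norm b))// lerDr.
Qed.

(** * Local suprema and the oscillation of the oscillation *)

Section local_suprema.
Context {R : realType} {d : nat}.
Variables (D : set (LRd R d)).
Implicit Types (f g : LRd R d -> R) (x y : LRd R d) (s t m M : R).

(** Local infima are handled as local suprema of [\- f], up to sign. *)
Definition localsup f s x : R := sup [set f y | y in eball x s `&` D].

Let localset_neq0 f s x : D x -> 0 < s ->
  [set f y | y in eball x s `&` D] !=set0.
Proof.
by move=> Dx s0; exists (f x), x => //; split=> //; rewrite eballE eudistxx.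
Qed.

Let localset_ub f M s x : (forall y, D y -> f y <= M) ->
  ubound [set f y | y in eball x s `&` D] M.
Proof. by move=> fM _ [y [_ Dy] <-]; exact: fM. Qed.

Lemma localsup_le f s x M : D x -> 0 < s ->
  (forall y, D y -> eball x s y -> f y <= M) -> localsup f s x <= M.
Proof.
move=> Dx s0 fM; apply: ge_sup; first exact: localset_neq0.
by move=> _ [y [xy Dy] <-]; exact: fM.
Qed.

Lemma localsup_ge f s x y M : (forall y, D y -> f y <= M) ->
  D y -> eball x s y -> f y <= localsup f s x.
Proof.
by move=> fM Dy xy; apply: ub_le_sup; [exists M; exact: localset_ub|exists y].
Qed.

Lemma localsup_mono f s t x y M : (forall y, D y -> f y <= M) ->
  D y -> 0 < s -> eudist y x + s <= t -> localsup f s y <= localsup f t x.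
Proof.
move=> fM Dy s0 st; apply: localsup_le => // z Dz yz.
by apply: (localsup_ge _ _ _ _ M) => //; exact: eball_subset yz.
Qed.

Definition superlevel f t : set (LRd R d) := [set y | D y /\ t < f y].

(** This turns levels of the local supremum into thickenings, to which the shell estimate
    applies. *)
Lemma localsup_gtP f s t x M : (forall y, D y -> f y <= M) -> D x -> 0 < s ->
  t < localsup f s x <-> thicken (superlevel f t) s x.
Proof.
move=> fM Dx s0; split.
  move=> /(sup_gt (localset_neq0 f s x Dx s0))[_ [y [xy Dy] <-] ty].
  by exists y => //; rewrite eballE eudistC.
move=> [y [Dy ty] xy]; apply: lt_le_trans ty _.
by apply: (localsup_ge _ _ _ _ M) => //; rewrite eballE eudistC.
Qed.

Lemma localsup_layers f (N : nat) m M s1 s2 x :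
  (forall y, D y -> m <= f y <= m + M) -> 0 < M -> (0 < N)%N ->
  0 < s1 <= s2 -> D x ->
  localsup f s2 x - localsup f s1 x <=
  M / N%:R * (1 + \sum_(k < N)
    \1_(thicken (superlevel f (m + k%:R * (M / N%:R))) s2 `\`
        thicken (superlevel f (m + k%:R * (M / N%:R))) s1) x).
Proof.
move=> fM M0 N0 /andP[s10 s12] Dx.
have s20 := lt_le_trans s10 s12.
have fub y : D y -> f y <= m + M by move=> /fM/andP[].
have xx s : 0 < s -> eball x s x by rewrite eballE eudistxx.
have N0' : 0 < (N%:R : R) by rewrite ltr0n.
set delta := M / N%:R.
have d0 : 0 < delta by rewrite divr_gt0.
(* The local supremum in units of [delta] above [m]: level [k] is exceeded exactly when
   [k < u s]. *)
pose u s := (localsup f s x - m) / delta.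
have uE s : localsup f s x = m + u s * delta.
  by rewrite /u divfK ?gt_eqF// addrC subrK.
have u0 s : 0 < s -> 0 <= u s.
  move=> s0; rewrite divr_ge0 ?subr_ge0//; last exact: ltW.
  apply: (@le_trans _ _ (f x)); first by have /andP[] := fM x Dx.
  exact: (localsup_ge _ _ _ _ _ fub Dx (xx _ s0)).
have uN s : 0 < s -> u s <= N%:R.
  move=> s0; rewrite ler_pdivrMr// /delta mulrC divfK ?gt_eqF//.
  by rewrite lerBlDl; apply: localsup_le => // y Dy _; exact: fub.
have uP s k : 0 < s -> (k%:R < u s) <->
    thicken (superlevel f (m + k%:R * delta)) s x.
  move=> s0; rewrite -(localsup_gtP _ _ _ _ _ fub Dx s0).
  by rewrite uE ltrD2l ltr_pM2r.
have [h2 _ _] := count_levels N (u s2) (u0 _ s20).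
have [_ _ h1] := count_levels N (u s1) (u0 _ s10).
rewrite (min_idPl (uN _ s20)) in h2.
rewrite !uE.
have -> : m + u s2 * delta - (m + u s1 * delta) = delta * (u s2 - u s1) by ring.
rewrite ler_pM2l//.
(* [u s2] is at most its count of levels and [u s1] at least its count less 1; this rounding is the
   term 1. *)
apply: (@le_trans _ _ (1 + (\sum_(k < N) (k%:R < u s2)%R%:R -
                            \sum_(k < N) (k%:R < u s1)%R%:R))).
  by move: h1 h2; lra.
rewrite lerD2l -sumrB; apply: ler_sum => k _.
(* A level counted for [s2] but not for [s1] puts [x] in the shell; any other level contributes at
   most 0. *)
rewrite indicE; case: (boolP (k%:R < u s1)) => [_|n1].
  apply: (@le_trans _ _ 0); last exact: ler0n.
  by rewrite subr_le0 ler_nat leq_b1.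
rewrite subr0; case: (boolP (k%:R < u s2)) => [l2|_]; last by rewrite ler0n.
rewrite mem_set//; split; first by apply/uP.
by move/(uP _ _ s10); apply/negP.
Qed.

Lemma osc_localsup f M s x : (forall y, D y -> `|f y| <= M) -> D x -> 0 < s ->
  osc D s f x = (localsup f s x + localsup (\- f) s x)%:E.
Proof.
move=> fM Dx s0; rewrite /osc /esupD /einfD.
have img g : [set (g y)%:E | y in eball x s `&` D] =
    EFin @` [set g y | y in eball x s `&` D].
  by rewrite image_comp.
rewrite !img ereal_sup_EFin; last exact: localset_neq0.
  rewrite ereal_inf_EFin; last exact: localset_neq0.
    by rewrite EFinD /inf EFinN oppeK /localsup image_comp.
  by exists (- M) => _ [y [_ Dy] <-]; have := fM y Dy; rewrite ler_norml => /andP[].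
by exists M => _ [y [_ Dy] <-]; exact: le_trans (ler_norm _) (fM y Dy).
Qed.

Lemma osc_osc_le f M r rho x : (forall y, D y -> `|f y| <= M) -> D x ->
  0 < rho < r ->
  (osc D rho (fun y => fine (osc D r f y)) x <=
   (localsup f (r + rho) x - localsup f (r - rho) x)%:E +
   (localsup (\- f) (r + rho) x - localsup (\- f) (r - rho) x)%:E)%E.
Proof.
move=> fM Dx /andP[rho0 rhor].
have r0 := lt_trans rho0 rhor.
have fub y : D y -> f y <= M by move=> /fM; exact: le_trans (ler_norm _).
have nfub y : D y -> (\- f) y <= M.
  by move=> /fM; apply: le_trans; rewrite -normrN; exact: ler_norm.
(* Every value of [osc D r f] within [rho] of [x] lies between [L] and [U], so its oscillation is at
   most [U - L]. *)
pose U := localsup f (r + rho) x + localsup (\- f) (r + rho) x.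
pose L := localsup f (r - rho) x + localsup (\- f) (r - rho) x.
have -> : ((localsup f (r + rho) x - localsup f (r - rho) x)%:E +
   (localsup (\- f) (r + rho) x - localsup (\- f) (r - rho) x)%:E =
   U%:E - L%:E)%E.
  by rewrite -EFinD -EFinB; congr EFin; rewrite /U /L; ring.
apply: leeB.
  apply: ge_ereal_sup => _ [y [xy Dy] <-]; rewrite (osc_localsup _ M)//= lee_fin.
  move: xy; rewrite eballE => xy.
  by apply: lerD; apply: (localsup_mono _ _ _ _ _ M) => //; rewrite addrC lerD2l ltW.
apply: le_ereal_inf_tmp => _ [y [xy Dy] <-]; rewrite (osc_localsup _ M)//= lee_fin.
move: xy; rewrite eballE eudistC => xy.
by apply: lerD; apply: (localsup_mono _ _ _ _ _ M) => //; rewrite ?subr_gt0//;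
  rewrite addrCA gerDl subr_le0 ltW.
Qed.

(** The inner oscillation takes its values in [[0, M]]. *)
Lemma osc_osc_le_diam f m M r rho x :
  (forall y, D y -> m <= f y <= m + M) -> D x -> 0 < rho -> 0 < r ->
  (osc D rho (fun y => fine (osc D r f y)) x <= M%:E)%E.
Proof.
move=> fmM Dx rho0 r0.
have fub y : D y -> f y <= m + M by move=> /fmM/andP[].
have nfub y : D y -> (\- f) y <= - m by move=> /fmM/andP[? ?]/=; rewrite lerN2.
have fM y : D y -> `|f y| <= `|m| + `|m + M| by move=> /fmM; exact: normr_itv_le.
rewrite -[M%:E]sube0; apply: leeB.
  apply: ge_ereal_sup => _ [y [xy Dy] <-].
  rewrite (osc_localsup _ _ _ _ fM)//= lee_fin.
  have -> : M = (m + M) + - m by ring.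
  by apply: lerD; apply: localsup_le => // z Dz _; [exact: fub|exact: nfub].
apply: le_ereal_inf_tmp => _ [y [xy Dy] <-].
rewrite (osc_localsup _ _ _ _ fM)//= lee_fin.
(* The lower bound 0 is split as [f y - f y], each part being below its own local supremum. *)
rewrite -(subrr (f y)); apply: lerD.
  by apply: (localsup_ge _ _ _ _ _ fub) => //; rewrite eballE eudistxx.
by apply: (localsup_ge (\- f) _ _ _ _ nfub) => //; rewrite eballE eudistxx.
Qed.

Lemma osc_ge0 f rho x : D x -> 0 < rho -> (0 <= osc D rho f x)%E.
Proof.
move=> Dx rho0.
have xx : (eball x rho `&` D) x by split=> //; rewrite eballE eudistxx.
rewrite -(@subee R (f x)%:E)//; apply: leeB.
  by apply: ereal_sup_ubound; exists x.
by apply: ereal_inf_lbound; exists x.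
Qed.

Lemma integral_osc_shell (mu : {measure set (LRd R d) -> \bar R}) f m M r rho
    (kappa b : R) : (1 <= d)%N -> measurable D ->
  (forall y, D y -> m <= f y <= m + M) -> 0 < M -> 0 < rho < r ->
  (mu D <= kappa%:E)%E ->
  (forall A, A `<=` D ->
    mu (D `&` (thicken A (r + rho) `\` thicken A (r - rho))) <= b%:E)%E ->
  (\int[mu]_(x in D) osc D rho (fun y => fine (osc D r f y)) x <=
   (2 * M * (rho / r * kappa + b))%:E)%E.
Proof.
move=> d1 mD fmM M0 rhor muD mub; have /andP[rho0 rho_r] := rhor.
have r0 := lt_trans rho0 rho_r.
have kappa0 : 0 <= kappa by rewrite -lee_fin; exact: le_trans muD.
have s1 : 0 < r - rho by rewrite subr_gt0.
have s12 : 0 < r - rho <= r + rho by apply/andP; split=> //; lra.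
have s2 : 0 < r + rho by rewrite addr_gt0.
(* [N > r / rho], so the rounding error [delta] is at most [M * (rho / r)]. *)
pose N := (Num.truncn (r / rho)).+1.
have N0 : 0 < (N%:R : R) by rewrite ltr0n.
pose delta := M / N%:R.
have d0 : 0 < delta by rewrite divr_gt0.
pose E g c k := thicken (superlevel g (c + k%:R * delta)) (r + rho) `\`
                thicken (superlevel g (c + k%:R * delta)) (r - rho).
have mE g c k : measurable (E g c k).
  by apply: measurableD; exact: measurable_thicken.
have muE g c k : (mu (E g c k `&` D) <= b%:E)%E.
  by rewrite setIC; apply: mub => y [].
have int_le g c := integral_layers_le mu D (E g c) N delta kappa b mD (mE g c)
  (ltW d0) muD (muE g c).
pose h g c x : \bar R := (delta * (1 + \sum_(k < N) \1_(E g c k) x))%:E.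
have h0 g c x : (0 <= h g c x)%E.
  by rewrite lee_fin mulr_ge0 ?ltW// ltr_pwDl// sumr_ge0.
have mh g c : measurable_fun D (h g c).
  apply/measurable_EFinP.
  apply: (@measurable_funM _ _ R D (cst delta)
    (fun x => 1 + \sum_(k < N) \1_(E g c k) x)); first exact: measurable_cst.
  apply: (@measurable_funD _ _ R D (cst 1)
    (fun x => \sum_(k < N) \1_(E g c k) x)); first exact: measurable_cst.
  apply: (@measurable_sum _ _ R D _ _ (fun (k : 'I_N) x => \1_(E g c k) x)) => k.
  exact: measurable_indic.
have fM y : D y -> `|f y| <= `|m| + `|m + M| by move=> /fmM; exact: normr_itv_le.
(* The range of [\- f] has the same width [M], with base level [- (m + M)]. *)
have nfmM y : D y -> - (m + M) <= (\- f) y <= - (m + M) + M.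
  by move=> /fmM/andP[h1 h2] /=; apply/andP; split; lra.
apply: (@le_trans _ _ (\int[mu]_(x in D) (h f m x + h (\- f)%R (- (m + M))%R x))%E).
  apply: ge0_le_integral_nomeas => x Dx; first exact: osc_ge0.
  apply: le_trans (osc_osc_le _ _ _ _ _ fM Dx rhor) _.
  by apply: leeD; rewrite lee_fin; exact: localsup_layers.
rewrite ge0_integralD//.
apply: le_trans (leeD (int_le f m) (int_le (\- f) (- (m + M)))) _.
rewrite -EFinD lee_fin.
have dN : delta * N%:R = M by rewrite /delta divfK// gt_eqF.
have drho : delta <= M * (rho / r).
  rewrite /delta ler_pM2l// -(invf_div r) lef_pV2 ?posrE ?divr_gt0//.
  by rewrite ltW// truncnS_gt.
have : delta * kappa <= M * (rho / r) * kappa by rewrite ler_wpM2r.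
(* Since [delta * N = M], the shells cost [M * b] however many levels there are. *)
have -> : delta * (kappa + N%:R * b) = delta * kappa + M * b by rewrite -dN; ring.
by lra.
Qed.

End local_suprema.

(** * The integral of the iterated oscillation for a multiple of Lebesgue measure *)

Section osc_osc_integral.
Context {R : realType} {d : nat}.
Variables (c : {nonneg R}) (D : set (LRd R d)).
Hypotheses (d1 : (1 <= d)%N) (c0 : 0 < c%:num) (mD : measurable D).

Local Notation mu := (mscale c (lebesgue_d R d)).
Local Notation K := (conv_hull D).

Lemma mscale_conv_hull_ge0 : (0 <= mu K)%E.
Proof.
apply: mule_ge0; first by rewrite lee_fin ltW.
exact: (@outer_measure_ge0 _ _ (leb_outer R d)).
Qed.

Lemma mscale_le_conv_hull : (mu D <= mu K)%E.
Proof.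
apply: lee_wpmul2l; first by rewrite lee_fin ltW.
by apply: (@le_outer_measure _ _ (leb_outer R d)); exact: sub_conv_hull.
Qed.

Lemma mscale_shell A (r rho : R) : A `<=` D -> 0 < rho < r ->
  (mu K < +oo)%E ->
  (mu (D `&` (thicken A (r + rho) `\` thicken A (r - rho))) <=
   (2 * d%:R * rho / r * fine (mu K))%:E)%E.
Proof.
move=> AD rhor Koo; have /andP[rho0 rho_r] := rhor.
have Kfin : mu K \is a fin_num by rewrite ge0_fin_numE// mscale_conv_hull_ge0.
have lebK0 : (0 <= leb_outer R d K)%E.
  exact: (@outer_measure_ge0 _ _ (leb_outer R d)).
have lebKoo : (leb_outer R d K < +oo)%E.
  rewrite ltey; apply/eqP => Ky; move: Koo.
  by rewrite /mscale /= /lebesgue_d Ky gt0_muley ?ltxx// lte_fin.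
rewrite EFinM fineK// /mscale muleCA; apply: lee_wpmul2l.
  by rewrite lee_fin ltW.
apply: le_trans (lebesgue_shell A D (r - rho) (r + rho) d1 mD AD _ lebKoo) _.
  by apply/andP; split; lra.
by apply: lee_wpmul2r => //; rewrite lee_fin; exact: Bernoulli_shell.
Qed.

Lemma integral_osc_osc_le f m M (r rho alpha : R) :
  (forall y, D y -> m <= f y <= m + M) -> 0 <= M -> 0 < r -> 0 < rho ->
  0 < alpha <= 1 ->
  (\int[mu]_(x in D) osc D rho (fun y => fine (osc D r f y)) x <=
   (2 * M * ((2 * d + 1)%:R / r * rho) `^ alpha)%:E * mu K)%E.
Proof.
move=> fmM M0 r0 rho0 /andP[alpha0 alpha1].
set tau := (2 * d + 1)%:R / r * rho.
have dpos : 0 < ((2 * d + 1)%:R : R) by rewrite ltr0n addn1.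
have tau0 : 0 < tau by rewrite mulr_gt0// divr_gt0.
have trivial_bound :
    (\int[mu]_(x in D) osc D rho (fun y => fine (osc D r f y)) x <= M%:E * mu D)%E.
  rewrite -(integral_cst mu mD); apply: ge0_le_integral_nomeas => x Dx.
    exact: osc_ge0.
  exact: (osc_osc_le_diam D f m).
(* For [tau >= 1] the bound by [M] suffices, as then [tau^alpha >= 1]. *)
have [tau1|tau1] := leP 1 tau.
  apply: le_trans trivial_bound _.
  apply: lee_pmul; rewrite ?lee_fin//; last exact: mscale_le_conv_hull.
  have : 1 <= tau `^ alpha by rewrite -(powRr0 tau) ler_powR// ltW.
  by move=> h; rewrite mulrAC ler_peMl//; lra.
(* [M = 0] is settled before an infinite [mu K], since [0 * +oo = 0]; the levels also need a
   positive height. *)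
have [M00|M_gt0] := eqVneq M 0.
  by apply: le_trans trivial_bound _; rewrite M00 mulr0 mul0r !mul0e.
have {}M_gt0 : 0 < M by rewrite lt_neqAle eq_sym M_gt0.
have [Koo|Koo] := ltP (mu K) +oo%E; last first.
  have -> : mu K = +oo%E by apply/eqP; rewrite -leye_eq.
  by rewrite gt0_muley ?leey// lte_fin !mulr_gt0// powR_gt0.
have Kfin : mu K \is a fin_num by rewrite ge0_fin_numE// mscale_conv_hull_ge0.
have rho_r : rho < r.
  apply: le_lt_trans (_ : (2 * d + 1)%:R * rho < r).
    by rewrite ler_peMl ?ler1n ?addn1// ltW.
  by move: tau1; rewrite /tau mulrAC ltr_pdivrMr// mul1r.
have rhor : 0 < rho < r by rewrite rho0.
have := integral_osc_shell D mu f m M r rho (fine (mu K))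
  (2 * d%:R * rho / r * fine (mu K)) d1 mD fmM M_gt0 rhor.
rewrite fineK// => /(_ mscale_le_conv_hull).
move=> /(_ (fun A AD => mscale_shell A r rho AD rhor Koo)).
move=> /le_trans; apply; rewrite -{3}(fineK Kfin) -EFinM lee_fin.
(* The rounding error and the shells combine to the factor [1 + 2 d] of [tau]. *)
have -> : 2 * M * (rho / r * fine (mu K) + 2 * d%:R * rho / r * fine (mu K)) =
    2 * M * tau * fine (mu K).
  by rewrite /tau natrD natrM; ring.
apply: ler_wpM2r; first by rewrite fine_ge0// mscale_conv_hull_ge0.
(* [tau <= tau^alpha], because [tau < 1] and [alpha <= 1]. *)
by rewrite ler_pM2l ?mulr_gt0// ger1_powR// tau0 ltW.
Qed.

End osc_osc_integral.

(** * The seminorm estimate, including empty [D] *)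

Lemma conv_hull0 {R : realType} {d : nat} : conv_hull (set0 : set (LRd R d)) = set0.
Proof.
apply/seteqP; split=> // x [[|n] [p [w [_ w1 p0 _]]]]; last exact: (p0 ord0).
by move: w1; rewrite big_ord0 => /esym/eqP; rewrite oner_eq0.
Qed.

Theorem theorem1 (R : realType) (d : nat) (hd : (1 <= d)%N)
  (c : {nonneg R}) (hc : 0 < c%:num)
  (D : set (LRd R d)) (hD : measurable D)
  (f : LRd R d -> R) (hf : exists M : R, forall x, D x -> `|f x| <= M)
  (r : R) (hr : 0 < r) (alpha : R) (ha0 : 0 < alpha) (ha1 : alpha <= 1) :
  (gH_seminorm (mscale c (lebesgue_d R d)) D alpha
     (fun x => fine (osc D r f x))
   <= 2%:E * (esupD D f - einfD D f) * mscale c (lebesgue_d R d) (conv_hull D)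
        * (((2 * d + 1)%:R / r) `^ alpha)%:E)%E.
Proof.
apply: ge_ereal_sup => _ [rho /= rho0 <-].
have [->|/set0P D0] := eqVneq D set0.
  (* For empty [D] the difference of supremum and infimum is [-oo]; the right side is still 0
     because the hull has measure 0 and [-oo * 0 = 0]. *)
  by rewrite conv_hull0 measure0 mule0 mul0e integral_set0 mule0.
have [B fB] := hf.
have ubf : has_ubound (f @` D).
  by exists B => _ [y Dy <-]; exact: le_trans (ler_norm _) (fB y Dy).
have lbf : has_lbound (f @` D).
  by exists (- B) => _ [y Dy <-]; have := fB y Dy; rewrite ler_norml => /andP[].
have fD0 : f @` D !=set0 by case: D0 => x Dx; exists (f x), x.
have -> : esupD D f = (sup (f @` D))%:E by rewrite -ereal_sup_EFin// image_comp.
have -> : einfD D f = (inf (f @` D))%:E by rewrite -ereal_inf_EFin// image_comp.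
set M := sup (f @` D) - inf (f @` D).
have fmM y : D y -> inf (f @` D) <= f y <= inf (f @` D) + M.
  move=> Dy; rewrite /M addrC subrK; apply/andP; split.
    by apply: ge_inf => //; exists y.
  by apply: ub_le_sup => //; exists y.
have M0 : 0 <= M.
  by case: D0 => x /fmM/andP[h1 h2]; rewrite -(lerDl (inf (f @` D))) (le_trans h1).
have a01 : 0 < alpha <= 1 by rewrite ha0.
have p0 : 0 < rho `^ alpha by rewrite powR_gt0.
have int_le :=
  integral_osc_osc_le c D hd hc hD f _ _ r rho alpha fmM M0 hr rho0 a01.
apply: le_trans (lee_wpmul2l _ int_le) _.
  by rewrite lee_fin invr_ge0 ltW.
have q0 : 0 <= (2 * d + 1)%:R / r by rewrite divr_ge0 ?ler0n// ltW.
(* Splitting off [rho^alpha] cancels the normalising factor of the seminorm and leaves a bound free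
   of [rho]. *)
rewrite (powRM _ q0 (ltW rho0)) muleA -EFinM -EFinB -/M -EFinM.
rewrite [leRHS]muleAC -EFinM.
rewrite (_ : (rho `^ alpha)^-1 * _ = 2 * M * ((2 * d + 1)%:R / r) `^ alpha)//.
by field; rewrite gt_eqF.
Qed.
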